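(* We have \[ \liminf_{n\to\infty}\frac{E^+(\mathcal{M}_n)}{n^{5/2}(\log n)^{3/2}}\geq\frac{4\sqrt{15}}{125}. \]
   Context: $\log$ is the natural logarithm. For an integer $n\geq1$, $\mathcal{M}_n$ is the set (repeated values counted once) of all multinomial coefficient values $\frac{n!}{p_1!\cdots p_t!}$, where $(p_1,\ldots,p_t)$ ranges over all integer partitions of $n$ ($p_1\geq\cdots\geq p_t\geq1$, $p_1+\cdots+p_t=n$). For a finite set $A$ of positive integers, the ordered additive energy is $E^+(A)=\#\{(x_1,x_2,x_3,x_4)\in A^4:x_1+x_2=x_3+x_4\}$. *)

(* Defs.v *)
From mathcomp Require Import all_boot all_order all_algebra finmap.
From mathcomp Require Import all_classical all_reals all_analysis.

Set Implicit Arguments.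
Unset Strict Implicit.
Unset Printing Implicit Defensive.

Local Open Scope nat_scope.
Local Open Scope classical_set_scope.
Local Open Scope fset_scope.

Definition is_partition (n : nat) (p : seq nat) : bool :=
  [&& sorted geq p, all (leq 1) p & sumn p == n].

(* The division is exact, see [multinomial_value_exact]. *)
Definition multinomial_value (p : seq nat) : nat :=
  (sumn p)`! %/ \prod_(i <- p) i`!.

Lemma multinomial_value_exact (p : seq nat) :
  multinomial_value p * \prod_(i <- p) i`! = (sumn p)`!.
Proof.
rewrite /multinomial_value divnK //.
elim: p => [|a p IHp] /=; first by rewrite big_nil.
rewrite big_cons -(bin_fact (leq_addr (sumn p) a)) addKn.
by rewrite dvdn_mull // dvdn_mul.
Qed.

Definition multinomial_values (n : nat) : set nat :=
  [set multinomial_value p | p in [set p | is_partition n p]].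

Lemma finite_multinomial_values (n : nat) : finite_set (multinomial_values n).
Proof.
apply: (sub_finite_set _ (finite_II (n`!).+1)) => _ [p /= /and3P[_ _ /eqP <-] <-].
by rewrite /= ltnS leq_div.
Qed.

(* [fset_set] is the identity on finite sets (and empty on infinite ones);
   here it is applied to a finite set, see [finite_multinomial_values]. *)
Definition Mset (n : nat) : {fset nat} := fset_set (multinomial_values n).

Lemma in_Mset (n m : nat) :
  reflect (exists2 p, is_partition n p & multinomial_value p = m) (m \in Mset n).
Proof.
by rewrite in_fset_set; [exact: asboolP | exact: finite_multinomial_values].
Qed.

Lemma Mset_gt0 (n m : nat) : m \in Mset n -> 0 < m.
Proof.
move=> /in_Mset[p _ <-]; have := fact_gt0 (sumn p).
by rewrite -multinomial_value_exact muln_gt0 => /andP[].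
Qed.

Definition additive_energy (A : {fset nat}) : nat :=
  #|` [fset x in A `*` A `*` A `*` A |
        let: (x1, x2, x3, x4) := x in (x1 + x2 == x3 + x4)%N]|.

(* Main.v *)
Require Import Defs.
From mathcomp Require Import all_boot all_order all_algebra.
From mathcomp Require Import all_classical all_reals all_analysis.
From mathcomp Require Import finmap zify lra.

(** Already the trivial solutions [x + y = x + y] give [E^+(A) >= |A|^2], so it
    suffices that [M_n] has many more than [n^{5/4} (log n)^{3/4}] elements.
    A multiset of primes can be read off the product of the factorials of its
    members (the largest prime divisor is the largest member, and so on), hence
    partitions of [n] into parts [5, 3, 2, 1] yield pairwise distinct multinomial
    coefficients, and there are at least [(n/10)^3] of them. Thus [E^+(M_n)] is
    at least [n^6/10^6], far more than [n^{5/2} (log n)^{3/2} <= n^4]. *)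

Import Order.TTheory GRing.Theory Num.Theory.

Local Open Scope nat_scope.

Lemma leq_sqr_additive_energy (A : {fset nat}) :
  (#|` A|%fset ^ 2 <= additive_energy A)%N.
Proof.
pose f (x y : nat) := (x, y, x, y).
rewrite -mulnn -(size_allpairs f) /additive_energy.
apply: uniq_leq_size.
  apply: allpairs_uniq; [exact: fset_uniq | exact: fset_uniq |].
  by move=> [a b] [c d] _ _ [-> ->].
move=> _ /allpairsP[[x y] /= [xA yA ->]].
rewrite inE /= inE /=; apply/andP; split; last exact: eqxx.
by rewrite /= !in_fsetM /= xA yA.
Qed.

(** The ones fill up to [n] and add only factors [1! = 1] to the product of factorials. Subtraction
    is truncated, so the sum is [n] only if [5c + 3b + 2a <= n]. *)
Definition parts5321 (n a b c : nat) : seq nat :=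
  nseq c 5 ++ nseq b 3 ++ nseq a 2 ++ nseq (n - (5 * c + 3 * b + 2 * a)) 1.

Lemma parts5321_is_partition (n a b c : nat) :
  5 * c + 3 * b + 2 * a <= n -> is_partition n (parts5321 n a b c).
Proof.
have pairwise_nseq (x m : nat) : pairwise geq (nseq m x).
  by elim: m => //= m ->; rewrite all_nseq /= leqnn orbT.
move=> le_n; apply/and3P; split.
- rewrite sorted_pairwise; last by move=> y x z /= xy yz; exact: leq_trans yz xy.
  rewrite /parts5321 !pairwise_cat !allrel_catr.
  by rewrite /allrel !all_nseq /= !all_nseq /= !orbT /= !pairwise_nseq.
- by rewrite /parts5321 !all_cat !all_nseq /= !orbT.
- rewrite /parts5321 !sumn_cat !sumn_nseq; apply/eqP; lia.
Qed.

Lemma prod_fact_parts5321 (n a b c : nat) :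
  \prod_(i <- parts5321 n a b c) i`! = 120 ^ c * (6 ^ b * 2 ^ a).
Proof.
rewrite /parts5321 !big_cat /= !big_nseq !iter_muln !muln1.
by rewrite exp1n muln1.
Qed.

(** As [120 = 2^3 * 3 * 5] and [6 = 2 * 3], the valuations form a triangular system: 5 gives [c],
    then 3 gives [b], then 2 gives [a]. *)
Lemma prod_fact_parts5321_inj (a b c a' b' c' : nat) :
  120 ^ c * (6 ^ b * 2 ^ a) = 120 ^ c' * (6 ^ b' * 2 ^ a') ->
  [/\ a = a', b = b' & c = c'].
Proof.
move=> E; have L p : c * logn p 120 + (b * logn p 6 + a * logn p 2) =
                     c' * logn p 120 + (b' * logn p 6 + a' * logn p 2).
  by move/(congr1 (logn p)): E; rewrite !lognM ?muln_gt0 ?expn_gt0 // !lognX.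
have L2 : c * 3 + (b * 1 + a * 1) = c' * 3 + (b' * 1 + a' * 1) := L 2.
have L3 : c * 1 + (b * 1 + a * 0) = c' * 1 + (b' * 1 + a' * 0) := L 3.
have L5 : c * 1 + (b * 0 + a * 0) = c' * 1 + (b' * 0 + a' * 0) := L 5.
by split; lia.
Qed.

(** Since [5 + 3 + 2 = 10], each of [a], [b], [c] may range freely over [0..n %/ 10]. *)
Lemma leq_card_Mset (n : nat) : (n %/ 10).+1 ^ 3 <= #|` Mset n|%fset.
Proof.
set k := (n %/ 10).+1.
pose f (t : 'I_k * 'I_k * 'I_k) :=
  multinomial_value (parts5321 n t.1.1 t.1.2 t.2).
have partn (t : 'I_k * 'I_k * 'I_k) :
    is_partition n (parts5321 n t.1.1 t.1.2 t.2).
  case: t => [[a b] c]; apply: parts5321_is_partition => /=.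
  have := ltn_ord a; have := ltn_ord b; have := ltn_ord c; rewrite /k.
  by move: (nat_of_ord a) (nat_of_ord b) (nat_of_ord c) => x y z; lia.
have finj : injective f.
  move=> t t' ff.
  have sumE (u : 'I_k * 'I_k * 'I_k) : sumn (parts5321 n u.1.1 u.1.2 u.2) = n.
    by case/and3P: (partn u) => _ _ /eqP.
  (* The numerator is always [n!], so equal values force equal products of factorials. *)
  have := multinomial_value_exact (parts5321 n t.1.1 t.1.2 t.2).
  rewrite sumE -[in RHS](sumE t') -multinomial_value_exact -/(f t) -/(f t') ff.
  move/eqP; rewrite eqn_pmul2l; last first.
    by apply: (@Mset_gt0 n); apply/in_Mset; exists (parts5321 n t'.1.1 t'.1.2 t'.2).
  rewrite !prod_fact_parts5321 => /eqP/prod_fact_parts5321_inj.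
  move: t t' {ff} => [[a b] c] [[a' b'] c'] /=.
  by case=> /val_inj-> /val_inj-> /val_inj->.
have -> : k ^ 3 = size (map f (enum {: 'I_k * 'I_k * 'I_k})).
  by rewrite size_map -cardE !card_prod !card_ord; lia.
apply: uniq_leq_size; first by rewrite map_inj_uniq ?enum_uniq.
move=> _ /mapP[t _ ->]; apply/in_Mset.
by exists (parts5321 n t.1.1 t.1.2 t.2).
Qed.

Local Open Scope ring_scope.

Lemma additive_energy_Mset_ge (R : realType) (n : nat) :
  (n%:R / 10) ^+ 6 <= (additive_energy (Mset n))%:R :> R.
Proof.
apply: (@le_trans _ _ (((n %/ 10).+1 ^ 3) ^ 2)%N%:R); last first.
  rewrite ler_nat; apply: leq_trans (leq_sqr_additive_energy _).
  by rewrite leq_sqr leq_card_Mset.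
rewrite -expnM natrX lerXn2r ?nnegrE ?divr_ge0 ?ler0n //.
rewrite ler_pdivrMr ?ltr0n // -natrM ler_nat; lia.
Qed.

Lemma limn_einf_ge (R : realType) (u : (\bar R)^nat) (c : \bar R) (N : nat) :
  (forall n, (N <= n)%N -> (c <= u n)%E) -> (c <= limn_einf u)%E.
Proof.
move=> cu; rewrite limn_einf_lim; apply: lime_ge; first exact: is_cvg_einfs.
exists N => // m /= Nm; apply: le_ereal_inf_tmp => _ [k /= mk <-].
exact/cu/(leq_trans Nm).
Qed.

(** Split [4 = 5/2 + 3/2] and use [0 <= ln x <= x]. *)
Lemma powR_mul_powR_ln_le (R : realType) (x : R) :
  1 <= x -> x `^ (5 / 2) * ln x `^ (3 / 2) <= x ^+ 4.
Proof.
move=> x1; have x0 : 0 < x by lra.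
have -> : x ^+ 4 = x `^ (5 / 2) * x `^ (3 / 2).
  rewrite -powRD; last by rewrite gt_eqF ?implybT.
  by rewrite -powR_mulrn ?ltW //; congr (_ `^ _); lra.
rewrite ler_pM2l ?powR_gt0 // ge0_ler_powR ?nnegrE ?ln_ge0 ?(ltW x0) //.
exact/ltW/ln_sublinear.
Qed.

Theorem corollary11p1 (R : realType) :
  ((4 * Num.sqrt 15 / 125 : R)%:E <=
   limn_einf (fun n : nat =>
     ((additive_energy (Mset n))%:R /
      (n%:R `^ (5 / 2) * ln n%:R `^ (3 / 2)) : R)%:E))%E.
Proof.
(* From 1000 on, [n^2 >= 10^6], hence [(n/10)^6 >= n^4]. *)
apply: (@limn_einf_ge _ _ _ 1000) => n n1000; rewrite lee_fin.
have x1000 : 1000 <= n%:R :> R by rewrite ler_nat.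
have sqrt15 : Num.sqrt 15 <= 4 :> R.
  rewrite (_ : 4 = Num.sqrt (4 ^+ 2)) ?ler_sqrt ?sqrtr_sqr ?ger0_norm //; lra.
(* The constant is at most [16/125 < 1], so a ratio of at least 1 suffices. *)
apply: (@le_trans _ _ 1); first lra.
rewrite ler_pdivlMr ?mul1r; last first.
  by rewrite mulr_gt0 ?powR_gt0 ?ln_gt0 //; lra.
apply: le_trans (additive_energy_Mset_ge R n).
apply: le_trans (powR_mul_powR_ln_le _ _ _) _; first lra.
move: x1000; move: (n%:R : R) => x x1000.
rewrite expr_div_n ler_pdivlMr ?exprn_gt0 ?ltr0n //.
rewrite (exprD x 4 2) ler_pM2l ?exprn_gt0 //; last lra.
nra.
Qed.
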